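(* The weight function $$w_5(\lambda,x)=\frac{(1+\lambda)^x-1}{\lambda x},\qquad \lambda>0,\ x>0,$$ is $\mathrm{STP}_\infty$.
   Context: A real function $w(\lambda,x)$ on $(0,\infty)\times(0,\infty)$ is $\mathrm{STP}_\infty$ (strictly totally positive of order infinity) if for every $r\ge 1$, all $\lambda_1>\cdots>\lambda_r>0$ and all $x_1>\cdots>x_r>0$, the $r\times r$ determinant $\det(w(\lambda_i,x_j))$ is $>0$. *)

(* Defs.v *)
(* MathComp-Analysis; the real numbers are an arbitrary [R : realType]. *)
From mathcomp Require Import all_boot all_order all_algebra.
From mathcomp Require Import all_classical all_reals all_analysis.

Set Implicit Arguments.
Unset Strict Implicit.
Unset Printing Implicit Defensive.

Import Order.TTheory GRing.Theory Num.Theory.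

Local Open Scope ring_scope.

(* A function on (0, oo) x (0, oo) is represented by a total function on R x R;
   only its values at positive arguments matter here. *)
Definition STP_infty (R : realType) (w : R -> R -> R) : Prop :=
  forall (r : nat) (lam x : 'I_r -> R), (1 <= r)%N ->
    (forall i, 0 < lam i) -> (forall i j : 'I_r, (i < j)%N -> lam j < lam i) ->
    (forall i, 0 < x i) -> (forall i j : 'I_r, (i < j)%N -> x j < x i) ->
    0 < \det (\matrix_(i < r, j < r) w (lam i) (x j)).

Definition w5 (R : realType) (lam x : R) : R :=
  ((1 + lam) `^ x - 1) / (lam * x).

(* Main.v *)
Require Import Defs.
From mathcomp Require Import all_boot all_order all_algebra.
From mathcomp Require Import all_classical all_reals all_analysis.
From mathcomp Require Import ring.

(** Up to positive row and column factors, with [b = ln (1 + lam)], the matrix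
    is [expR (b i * x j) - 1].  Expanding its determinant along the first row
    gives, as a function [f] of [b 0], an exponential sum with the [r + 1]
    exponents [x 0, ..., x (r - 1), 0].  It vanishes at the [r] points
    [b 1, ..., b (r - 1), 0], and its leading coefficient is a smaller
    determinant of the same kind, positive by induction.  Rolle's theorem then
    yields, in the style of Descartes' rule of signs, that [f] is positive to
    the right of its largest zero. *)

Set Implicit Arguments.
Unset Strict Implicit.
Unset Printing Implicit Defensive.

Import Order.TTheory GRing.Theory Num.Theory.
Import numFieldNormedType.Exports.

Local Open Scope classical_set_scope.
Local Open Scope ring_scope.

Section ExponentialSums.
Variable R : realType.
Implicit Types (n : nat) (c x b : nat -> R) (t : R).

Definition expsum n c x t : R := \sum_(j < n) c j * expR (t * x j).

Lemma is_derive_expsum n c x t :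
  is_derive t 1 (expsum n c x) (expsum n (fun j => c j * x j) x t).
Proof.
have -> : expsum n c x = \sum_(j < n) (fun s => c j * expR (s * x j)).
  by apply/funext => s; rewrite fct_sumE.
apply: is_derive_sum => j.
have dM : is_derive t 1 (fun s : R => s * x j) (x j).
  by apply: is_derive_eq; rewrite scaler0 add0r /GRing.scale /= mulr1.
have -> : c j * x j * expR (t * x j) = c j *: (expR (t * x j) * x j).
  by rewrite /GRing.scale /=; ring.
by apply: (@is_deriveZ _ _ _ (expR \o (fun s => s * x j))); apply: is_derive1_comp.
Qed.

Lemma within_continuous_expsum n c x (A : set R) :
  {within A, continuous (expsum n c x)}.
Proof.
apply: continuous_subspaceT => t.
apply: differentiable_continuous; apply/derivable1_diffP.
by have [] := is_derive_expsum n c x t.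
Qed.

Lemma expsum_shift n c x a t :
  expsum n c x t = expR (t * a) * expsum n c (fun j => x j - a) t.
Proof.
rewrite /expsum big_distrr /=; apply: eq_bigr => j _.
by rewrite mulrCA -expRD -mulrDr addrC subrK.
Qed.

(** Induction on [n]. Once the last exponential is divided out, the derivative has one term fewer
    and, by Rolle, one known zero fewer. It is then positive to the right of [b 0], so the quotient
    increases from its zero at [b 0]. *)
Lemma expsum_gt0 n c x b t : 0 < c 0 ->
  (forall i j, (i < j <= n)%N -> x j < x i) ->
  (forall i, (i.+1 < n)%N -> b i.+1 < b i) ->
  (forall i, (i < n)%N -> expsum n.+1 c x (b i) = 0) ->
  (forall i, (i < n)%N -> b i < t) ->
  0 < expsum n.+1 c x t.
Proof.
elim: n c x b t => [|n IHn] c x b t c0 x_decr b_decr fb0 b_lt.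
  by rewrite /expsum big_ord1 mulr_gt0 ?expR_gt0.
(* Factoring out [expR (t * x n.+1)] makes the last term constant, so that
   differentiation removes it. *)
pose y j := x j - x n.+1.
have gE s : expsum n.+2 c x s = expR (s * x n.+1) * expsum n.+2 c y s.
  exact: expsum_shift.
have g0 i : (i < n.+1)%N -> expsum n.+2 c y (b i) = 0.
  move=> /fb0/eqP; rewrite gE mulf_eq0 gt_eqF ?expR_gt0 //=.
  by move/eqP.
pose c' j := c j * y j.
have dgE (s : R) : is_derive s 1 (expsum n.+2 c y) (expsum n.+1 c' y s).
  apply: is_derive_eq; first exact: is_derive_expsum.
  by rewrite /expsum big_ord_recr /= [y n.+1]subrr mulr0 mul0r addr0.
(* Rolle points [d i], one in each gap between consecutive zeros; the value 0 for [i >= n] is a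
   dummy. *)
have [d dP] : {d : nat -> R & forall i, (i < n)%N ->
    b i.+1 < d i < b i /\ expsum n.+1 c' y (d i) = 0}.
  apply: (choice (P := fun i d => (i < n)%N ->
    b i.+1 < d < b i /\ expsum n.+1 c' y d = 0)) => i.
  have [i_lt|_] := ltnP i n; last by exists 0.
  have [] := @MVT R _ _ _ _ (b_decr i i_lt) (fun s _ => dgE s).
    exact: within_continuous_expsum.
  move=> d; rewrite in_itv /= => d_itv /esym/eqP.
  rewrite !g0 ?ltnS // 1?ltnW // subrr mulf_eq0 => /orP[/eqP d0|].
    by exists d.
  by rewrite subr_eq0 gt_eqF ?b_decr.
have dg_gt0 (s : R) : b 0 < s -> 0 < expsum n.+1 c' y s.
  move=> b0_lt; apply: (IHn _ _ d) => [|i j /andP[ij jn]|i i_lt|i /dP[] //|].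
  (* The leading coefficient stays positive because [x n.+1] is the smallest exponent. *)
  - by rewrite /c' /y mulr_gt0 ?subr_gt0 ?x_decr ?leqnn.
  - by rewrite /y ltrD2r x_decr // ij leqW.
  - have [/andP[+ _] _] := dP _ (ltnW i_lt).
    by have [/andP[_ +] _] := dP _ i_lt; apply: lt_trans.
  - move=> i i_lt; have [/andP[_ /lt_trans->] //] := dP _ i_lt.
    apply: le_lt_trans b0_lt; elim: i i_lt => // i IHi i_lt.
    by apply: le_trans (IHi (ltnW i_lt)); apply/ltW/b_decr/ltnW.
rewrite gE mulr_gt0 ?expR_gt0 //.
have [] := @MVT R _ _ _ _ (b_lt 0 isT) (fun s _ => dgE s).
  exact: within_continuous_expsum.
move=> s; rewrite in_itv /= => /andP[b0_lt _]; rewrite g0 // subr0 => ->.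
by rewrite mulr_gt0 ?dg_gt0 // subr_gt0 b_lt.
Qed.

Lemma det_expRB1_gt0 r (b x : 'I_r -> R) :
  (forall i, 0 < b i) -> (forall i j : 'I_r, (i < j)%N -> b j < b i) ->
  (forall i, 0 < x i) -> (forall i j : 'I_r, (i < j)%N -> x j < x i) ->
  0 < \det (\matrix_(i < r, j < r) (expR (b i * x j) - 1)).
Proof.
elim: r b x => [|r IHr] b x b_gt0 b_decr x_gt0 x_decr; first by rewrite det_mx00.
pose M t : 'M[R]_r.+1 := \matrix_(i, j)
  (expR ((if i == ord0 then t else b i) * x j) - 1).
(* Cofactors along row 0 do not involve that row, so [M 0] stands for any [M t]. *)
pose cof j := cofactor (M 0) ord0 j.
have detM t : \det (M t) = \sum_j (expR (t * x j) - 1) * cof j.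
  rewrite (expand_det_row _ ord0); apply: eq_bigr => j _.
  rewrite mxE eqxx; congr (_ * (_ * \det _)).
  by apply/matrixP => i k; rewrite !mxE.
(* The defaults of [oapp] supply the last entries. The terms [-1] of row 0 collect into a constant
   with exponent 0, below every [x j], and the point 0 is the last zero, below every [b i]. *)
pose c k := oapp cof (- \sum_j cof j) (insub k : option 'I_r.+1).
pose x' k := oapp x 0 (insub k : option 'I_r.+1).
pose b' k := oapp (b \o lift ord0) 0 (insub k : option 'I_r).
have fE t : expsum r.+2 c x' t = \det (M t).
  rewrite /expsum big_ord_recr /= {2}/c {2}/x' insubF ?ltnn //=.
  rewrite mulr0 expR0 mulr1 detM -sumrB; apply: eq_bigr => j _.
  by rewrite /c /x' /= valK /= mulrBl mul1r mulrC.
have -> : \matrix_(i < r.+1, j < r.+1) (expR (b i * x j) - 1) = M (b ord0).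
  by apply/matrixP => i j; rewrite !mxE; case: eqP => // ->.
rewrite -fE; apply: (@expsum_gt0 _ _ _ b') => [|i j /andP[ij jr]|i i_lt|i i_lt|i i_lt].
- have -> : c 0%N = cof ord0 by rewrite /c (valK (@ord0 r)).
  rewrite /cof /cofactor expr0 mul1r.
  have -> : row' ord0 (col' ord0 (M 0)) = \matrix_(i, j)
      (expR (b (lift ord0 i) * x (lift ord0 j)) - 1).
    by apply/matrixP => i j; rewrite !mxE.
  by apply: IHr => [i|i j ij|i|i j ij] //; [apply: b_decr|apply: x_decr].
- rewrite /x' (insubT (fun k => k < r.+1)%N (leq_trans ij jr)) /=.
  by case: insubP => [k _ kj|_] /=; [apply: x_decr; rewrite kj|].
- rewrite /b' (insubT (fun k => k < r)%N (i_lt : (i < r)%N)) /=.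
  by case: insubP => [k _ ki|_] /=; [apply: b_decr; rewrite /= /bump /= ki|].
(* At [b (lift ord0 k)] two rows of [M] coincide; at 0 its row 0 vanishes. *)
- rewrite fE /b'; case: insubP => [k _ _|_] /=.
    apply: (determinant_alternate (neq_lift ord0 k)) => j.
    by rewrite !mxE eqxx.
  by rewrite detM big1 // => j _; rewrite mul0r expR0 subrr mul0r.
- by rewrite /b'; case: insubP => [k _ _|_] /=; [apply: b_decr|].
Qed.

End ExponentialSums.

Theorem mainTheorem8 (R : realType) : STP_infty (@w5 R).
Proof.
move=> r lam x _ lam_gt0 lam_decr x_gt0 x_decr.
have lam1_gt0 i : 0 < 1 + lam i by rewrite addr_gt0.
set A := \matrix_(i, j) _.
(* The denominator [lam i * x j] splits into positive row and column scalings. *)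
have -> : A = diag_mx (\row_i (lam i)^-1) *m
    ((\matrix_(i, j) (expR (ln (1 + lam i) * x j) - 1)) *m
     diag_mx (\row_j (x j)^-1)).
  rewrite mul_mx_diag mul_diag_mx; apply/matrixP => i j.
  by rewrite !mxE /w5 /powR gt_eqF // invfM [x j * _]mulrC mulrCA.
rewrite !det_mulmx !det_diag; apply: mulr_gt0; last apply: mulr_gt0.
- by apply: prodr_gt0 => i _; rewrite mxE invr_gt0.
- apply: det_expRB1_gt0 => // [i|i j ij].
    by rewrite ln_gt0 // ltrDl.
  by rewrite ltr_ln ?posrE // ltrD2l lam_decr.
- by apply: prodr_gt0 => i _; rewrite mxE invr_gt0.
Qed.
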